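(* Every $H_{mm}$-nest of modular-magic Sudoku boards contains exactly one modular-magic board $B=(B(r,c))_{1\le r,c\le 9}$ satisfying all of the following: $B(1,1)=0$, $B(1,4)=3$, $B(1,7)=6$, $B(2,2)=3$, $B(2,5)=6$, $B(2,8)=0$, $B(3,3)=6$, $B(3,6)=0$, $B(3,9)=3$, $B(4,1)=3$, $B(4,4)=6$, $B(4,7)=0$, $B(5,2)=6$, $B(5,5)=0$, $B(5,8)=3$, $B(6,3)=0$, $B(6,6)=3$, $B(6,9)=6$, $B(7,1)=6$, $B(7,4)=0$, $B(7,7)=3$, $B(8,2)=0$, $B(8,5)=3$, $B(8,8)=6$, $B(9,3)=3$, $B(9,6)=6$, $B(9,9)=0$, and moreover $B(1,3)<B(3,1)$ and $B(4,9)=B(7,6)$.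
   Context: A Sudoku board is a $9\times 9$ array with entries from $\{0,\dots,8\}$, rows indexed $1,\dots,9$ top to bottom and columns $1,\dots,9$ left to right, such that every row, every column, and every $3\times 3$ block (rows $3a+1,\dots,3a+3$, columns $3b+1,\dots,3b+3$) contains each symbol exactly once. Bands are the three horizontal strips of three blocks, pillars the three vertical strips. A modular-magic Sudoku board is a Sudoku board in which, for every block, the entries of each of its three rows, three columns and two diagonals sum to a multiple of $9$. The physical Sudoku symmetry group $H_9$ is the group of rearrangements of the $81$ cells generated by permutations of the bands, permutations of the rows within a band, permutations of the pillars, permutations of the columns within a pillar, and the transpose; it acts on boards by moving entries. $H_{mm}$ is the subgroup of $H_9$ consisting of the elements that map every modular-magic board to a modular-magic board (it has order $4608$). Two modular-magic boards lie in the same $H_{mm}$-nest if one is obtained from the other by an element of $H_{mm}$. *)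

(* Defs.v *)
From HB Require Import structures.
From mathcomp Require Import all_boot all_order all_fingroup.
Set Implicit Arguments. Unset Strict Implicit. Unset Printing Implicit Defensive.

(* Cells: (row, column), 0-based: paper row r (1..9) is index r-1.
   Row index i lies in band i %/ 3 at position i %% 3 within the band;
   similarly column j lies in pillar j %/ 3. *)
Definition cell : finType := ('I_9 * 'I_9)%type.

Definition board : finType := {ffun cell -> 'I_9}.

(* Paper-style 1-based access to entries, as natural numbers. *)
Definition ent (B : board) (r c : nat) : nat :=
  val (B (inord (r - 1), inord (c - 1))).

Definition sudoku (B : board) : bool :=
  [forall r : 'I_9, forall k : 'I_9, #|[set c : 'I_9 | B (r, c) == k]| == 1]
  && [forall c : 'I_9, forall k : 'I_9, #|[set r : 'I_9 | B (r, c) == k]| == 1]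
  && [forall a : 'I_3, forall b : 'I_3, forall k : 'I_9,
        #|[set x : cell | (x.1 %/ 3 == a) && (x.2 %/ 3 == b) && (B x == k)]| == 1].

Definition bcell (a b i j : 'I_3) : cell := (inord (3 * a + i), inord (3 * b + j)).

Definition modmagic (B : board) : bool :=
  [forall a : 'I_3, forall b : 'I_3,
     [forall i : 'I_3, 9 %| \sum_(j < 3) val (B (bcell a b i j))]
  && [forall j : 'I_3, 9 %| \sum_(i < 3) val (B (bcell a b i j))]
  && (9 %| \sum_(i < 3) val (B (bcell a b i i)))
  && (9 %| \sum_(i < 3) val (B (bcell a b i (inord (2 - i)))))].

Definition mmboard (B : board) : bool := sudoku B && modmagic B.

Definition band_perms : {set {perm cell}} :=
  [set g : {perm cell} | [exists p : {perm 'I_3}, [forall x : cell,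
     (val (g x).1 == 3 * val (p (inord (x.1 %/ 3))) + x.1 %% 3) && ((g x).2 == x.2)]]].
Definition rowinband_perms : {set {perm cell}} :=
  [set g : {perm cell} | [exists b : 'I_3, exists p : {perm 'I_3}, [forall x : cell,
     (if x.1 %/ 3 == b then val (g x).1 == 3 * b + val (p (inord (x.1 %% 3)))
      else (g x).1 == x.1) && ((g x).2 == x.2)]]].
Definition pillar_perms : {set {perm cell}} :=
  [set g : {perm cell} | [exists p : {perm 'I_3}, [forall x : cell,
     (val (g x).2 == 3 * val (p (inord (x.2 %/ 3))) + x.2 %% 3) && ((g x).1 == x.1)]]].
Definition colinpillar_perms : {set {perm cell}} :=
  [set g : {perm cell} | [exists b : 'I_3, exists p : {perm 'I_3}, [forall x : cell,
     (if x.2 %/ 3 == b then val (g x).2 == 3 * b + val (p (inord (x.2 %% 3)))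
      else (g x).2 == x.2) && ((g x).1 == x.1)]]].
Definition transpose_perms : {set {perm cell}} :=
  [set g : {perm cell} | [forall x : cell, g x == (x.2, x.1)]].

Definition H9_gens : {set {perm cell}} :=
  band_perms :|: rowinband_perms :|: pillar_perms :|: colinpillar_perms
  :|: transpose_perms.

Definition H9 : {group {perm cell}} := <<H9_gens>>%G.

(* Action on boards by moving entries: the entry at cell x moves to cell g x. *)
Definition bact (g : {perm cell}) (B : board) : board := [ffun x => B ((g^-1)%g x)].

Definition Hmm : {set {perm cell}} :=
  [set g in H9 | [forall B : board, mmboard B ==> mmboard (bact g B)]].

Definition nest (B0 : board) : {set board} := [set bact g B0 | g in Hmm].

Definition normal_form (B : board) : Prop :=
  ent B 1 1 = 0 /\
  ent B 1 4 = 3 /\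
  ent B 1 7 = 6 /\
  ent B 2 2 = 3 /\
  ent B 2 5 = 6 /\
  ent B 2 8 = 0 /\
  ent B 3 3 = 6 /\
  ent B 3 6 = 0 /\
  ent B 3 9 = 3 /\
  ent B 4 1 = 3 /\
  ent B 4 4 = 6 /\
  ent B 4 7 = 0 /\
  ent B 5 2 = 6 /\
  ent B 5 5 = 0 /\
  ent B 5 8 = 3 /\
  ent B 6 3 = 0 /\
  ent B 6 6 = 3 /\
  ent B 6 9 = 6 /\
  ent B 7 1 = 6 /\
  ent B 7 4 = 0 /\
  ent B 7 7 = 3 /\
  ent B 8 2 = 0 /\
  ent B 8 5 = 3 /\
  ent B 8 8 = 6 /\
  ent B 9 3 = 3 /\
  ent B 9 6 = 6 /\
  ent B 9 9 = 0 /\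
  ent B 1 3 < ent B 3 1 /\
  ent B 4 9 = ent B 7 6.

(* Main.v *)
Require Import Defs.
From mathcomp Require Import all_boot all_order all_fingroup.
From mathcomp Require Import zify.
Set Implicit Arguments. Unset Strict Implicit. Unset Printing Implicit Defensive.

(** In a magic block the centre is a multiple of 3, the edge cells are not, and each
outer row or column contains at most one multiple of 3.  Hence an element of [H9] that
preserves modular-magic boards must permute the block centres, and [Hmm] consists of the
elements [(r, c) |-> (s r, t c)], up to transposition, where [s] and [t] permute the
bands and inside each band fix or reflect it about its middle line.

Existence: moving 0, 3, 6 of the first row, then of a column, by such [s] and [t] one
may assume that the top left corners of the blocks of the first band and pillar are
0, 3, 6.  An exhaustive search finds 84 such boards, and each is brought to normal form by
cyclic shifts of bands and pillars, a global reflection and transposition.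
Uniqueness: for each normal board among them, each of the 4608 elements of [Hmm] either
fixes it or destroys the normal form. *)

(** * Exhaustive search *)

Section Search.
Variables (alph : nat -> seq nat) (peers : nat -> seq nat).
Variable (lines : seq (nat * nat * nat)).

(* The values at positions [0 .. k - 1] are stored latest first, so position [i] sits at
   index [k - i.+1]; [ds] and [es] are lists of such indices. *)
Definition admissible (ds : seq nat) (es : seq (nat * nat)) (s : seq nat) (v : nat)
  : bool :=
  all (fun d => ~~ eqn (nth 0 s d) v) ds &&
  all (fun e => eqn ((nth 0 s e.1 + nth 0 s e.2 + v) %% 9) 0) es.

(** The index lists are bound outside the maps, so they are computed once per level and not once per
    partial solution. A line is tested at its last position, when its other two entries are
    known. *)
Definition step (k : nat) (L : seq (seq nat)) : seq (seq nat) :=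
  let vs := alph k in
  let ds := [seq k - i.+1 | i <- peers k] in
  let es := [seq (k - l.1.1.+1, k - l.1.2.+1) | l <- lines & eqn l.2 k] in
  flatten [seq [seq v :: s | v <- vs & admissible ds es s v] | s <- L].

Fixpoint search (n : nat) : seq (seq nat) :=
  if n is k.+1 then step k (search k) else [:: [::]].

Fixpoint prefix_stack (x : nat -> nat) (n : nat) : seq nat :=
  if n is k.+1 then x k :: prefix_stack x k else [::].

Lemma nth_prefix_stack x n i : i < n -> nth 0 (prefix_stack x n) (n - i.+1) = x i.
Proof.
elim: n => // n IH; rewrite ltnS leq_eqVlt => /orP[/eqP->|lt_in].
  by rewrite subnn.
by rewrite subSS -(IH lt_in) (_ : n - i = (n - i.+1).+1) //; lia.
Qed.

(** Completeness: each test at level [k] is a condition that [x] itself satisfies, so its prefix is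
    never pruned. The bounds on peers and lines ensure that only filled positions are read, never
    the default of [nth]. *)
Lemma mem_search (x : nat -> nat) n :
    (forall k, k < n -> x k \in alph k) ->
    (forall k i, k < n -> i \in peers k -> i < k /\ x i <> x k) ->
    (forall l, l \in lines -> l.2 < n ->
       [/\ l.1.1 < l.2, l.1.2 < l.2 & 9 %| x l.1.1 + x l.1.2 + x l.2]) ->
  prefix_stack x n \in search n.
Proof.
elim: n => // n IH xa xp xl /=.
apply/flattenP; exists [seq v :: prefix_stack x n | v <- alph n &
    admissible [seq n - i.+1 | i <- peers n]
      [seq (n - l.1.1.+1, n - l.1.2.+1) | l <- lines & eqn l.2 n] (prefix_stack x n) v].
  apply: (map_f (fun s => [seq v :: s | v <- alph n & admissible _ _ s v])).
  by apply: IH => [k kn|k i kn|l ll ln]; [apply: xa|apply: xp|apply: xl] => //; apply: ltnW.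
apply: (map_f (fun v => v :: prefix_stack x n)).
rewrite mem_filter xa // andbT /admissible; apply/andP; split.
  apply/allP => _ /mapP[i ip ->]; have [lt_in ne] := xp n i (leqnn _) ip.
  by rewrite nth_prefix_stack // eqnE; apply/eqP.
apply/allP => _ /mapP[l + ->] /=; rewrite mem_filter => /andP[/eqnP ln ll].
have [] := xl l ll; first by rewrite ln.
by rewrite ln => l1 l2 dv; rewrite !nth_prefix_stack.
Qed.

End Search.

(** Rows, columns and diagonals of a block read row by row. Each triple is increasing, so that the
    search can test it at its last position. *)
Definition block_lines : seq (nat * nat * nat) :=
  [:: (0, 1, 2); (3, 4, 5); (6, 7, 8); (0, 3, 6); (1, 4, 7); (2, 5, 8);
      (0, 4, 8); (2, 4, 6)].

Definition magic_blocks : seq (seq nat) :=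
  search (fun=> iota 0 9) (fun k => iota 0 k) block_lines 9.

Definition board_lines : seq (nat * nat * nat) :=
  [seq (9 * q + l.1.1, 9 * q + l.1.2, 9 * q + l.2) | q <- iota 0 9, l <- block_lines].

(* Positions [0 .. 80] run through the board block by block. *)
Definition pos_row p := 3 * (p %/ 27) + (p %% 9) %/ 3.
Definition pos_col p := 3 * (p %/ 9 %% 3) + (p %% 9) %% 3.

Definition board_peers (p : nat) : seq nat :=
  [seq i <- iota 0 p | [|| eqn (p %/ 9) (i %/ 9), eqn (pos_row p) (pos_row i)
                         | eqn (pos_col p) (pos_col i)]].

(** Positions 0, 9, 18, 27 and 54 are the top left corners of the blocks in the first band and the
    first pillar. *)
Definition board_alph (p : nat) : seq nat :=
  if eqn p 0 then [:: 0] else if eqn p 9 then [:: 3] else if eqn p 18 then [:: 6]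
  else if eqn p 27 then [:: 3] else if eqn p 54 then [:: 6] else iota 0 9.

Definition solutions := search board_alph board_peers board_lines 81.

(** The possible images of a band: one of the three bands, in order or reversed. *)
Definition centred_triples : seq (seq nat) :=
  [:: [:: 0; 1; 2]; [:: 2; 1; 0]; [:: 3; 4; 5]; [:: 5; 4; 3]; [:: 6; 7; 8]; [:: 8; 7; 6]].
(** Lists of images of 0 to 8. The [uniq] filter makes the three bands distinct, which leaves 6 * 8
    = 48 codes; with the transposition, 2 * 48 * 48 = 4608. *)
Definition centred_codes : seq (seq nat) :=
  [seq s <- [seq x ++ yz | x <- centred_triples,
        yz <- [seq y ++ z | y <- centred_triples, z <- centred_triples]] | uniq s].

Definition entry (m : seq (seq nat)) r c := nth 0 (nth [::] m r) c.

Definition matrix_of (s : seq nat) : seq (seq nat) :=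
  [seq [seq nth 0 s (80 - (27 * (r %/ 3) + 9 * (c %/ 3) + 3 * (r %% 3) + c %% 3))
       | c <- iota 0 9] | r <- iota 0 9].

(** The codes [u] and [v] stand for inverses of the row and column permutations, since moving
    entries reads the old board at the preimage of a cell. *)
Definition moved (b : bool) (u v : seq nat) (m : seq (seq nat)) (r c : nat) : nat :=
  if b then entry m (nth 0 u c) (nth 0 v r) else entry m (nth 0 u r) (nth 0 v c).

Definition normal_entries : seq (nat * nat * nat) :=
  [:: (0, 0, 0); (0, 3, 3); (0, 6, 6); (1, 1, 3); (1, 4, 6); (1, 7, 0);
      (2, 2, 6); (2, 5, 0); (2, 8, 3); (3, 0, 3); (3, 3, 6); (3, 6, 0);
      (4, 1, 6); (4, 4, 0); (4, 7, 3); (5, 2, 0); (5, 5, 3); (5, 8, 6);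
      (6, 0, 6); (6, 3, 0); (6, 6, 3); (7, 1, 0); (7, 4, 3); (7, 7, 6);
      (8, 2, 3); (8, 5, 6); (8, 8, 0)].

Definition normalb (f : nat -> nat -> nat) : bool :=
  [&& all (fun e => eqn (f e.1.1 e.1.2) e.2) normal_entries,
      f 0 2 < f 2 0 & eqn (f 3 8) (f 6 5)].

(* The cyclic shifts of the bands, without and with a reflection of every band. *)
Definition short_codes : seq (seq nat) :=
  [:: [:: 0; 1; 2; 3; 4; 5; 6; 7; 8]; [:: 3; 4; 5; 6; 7; 8; 0; 1; 2];
      [:: 6; 7; 8; 0; 1; 2; 3; 4; 5]; [:: 2; 1; 0; 5; 4; 3; 8; 7; 6];
      [:: 5; 4; 3; 8; 7; 6; 2; 1; 0]; [:: 8; 7; 6; 2; 1; 0; 5; 4; 3]].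

Definition normalizable (m : seq (seq nat)) : bool :=
  has (fun b => has (fun u => has (fun v => normalb (moved b u v m))
    short_codes) short_codes) [:: false; true].

(* Written with [if] because [==>] is strict under [vm_compute]. *)
Definition rigid (m : seq (seq nat)) : bool :=
  if normalb (entry m) then
    all (fun b => all (fun u => all (fun v =>
      if normalb (moved b u v m) then
        all (fun r => all (fun c => eqn (moved b u v m r c) (entry m r c))
          (iota 0 9)) (iota 0 9)
      else true) centred_codes) centred_codes) [:: false; true]
  else true.

(** The checks for existence and for uniqueness are joined so that the search runs only once. *)
Lemma solutions_check :
  all (fun s => let m := matrix_of s in normalizable m && rigid m) solutions.
Proof. by vm_compute. Qed.

(** * The groups [H9] and [Hmm] *)

Import GroupScope.

Lemma inord9 (r : 'I_9) (k : nat) : k = r :> nat -> inord k = r.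
Proof. by move=> ->; rewrite inord_val. Qed.

Lemma band_lt (i : 'I_9) : i %/ 3 < 3.
Proof. by rewrite ltn_divLR. Qed.

Lemma cell_eq (x y : cell) : x.1 = y.1 :> nat -> x.2 = y.2 :> nat -> x = y.
Proof. by case: x y => [? ?] [? ?] /= /val_inj-> /val_inj->. Qed.

Lemma prodp_inj (s t : {perm 'I_9}) : injective (fun x : cell => (s x.1, t x.2) : cell).
Proof. by move=> [a b] [c d] [/perm_inj-> /perm_inj->]. Qed.

Definition prodp (s t : {perm 'I_9}) : {perm cell} := perm (@prodp_inj s t).

Lemma flip_inj : injective (fun x : cell => (x.2, x.1) : cell).
Proof. by move=> [a b] [c d] [-> ->]. Qed.

Definition flip : {perm cell} := perm flip_inj.

Lemma prodpE s t x : prodp s t x = (s x.1, t x.2).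
Proof. by rewrite permE. Qed.

Lemma flipE x : flip x = (x.2, x.1).
Proof. by rewrite permE. Qed.

Lemma prodpM s t s' t' : prodp s t * prodp s' t' = prodp (s * s') (t * t').
Proof. by apply/permP => x; rewrite permM !prodpE !permM. Qed.

Lemma prodpV s t : (prodp s t)^-1 = prodp s^-1 t^-1.
Proof.
apply: (mulgI (prodp s t)); rewrite mulgV prodpM !mulgV.
by apply/permP => -[a b]; rewrite prodpE !perm1.
Qed.

Lemma flipK : flip * flip = 1.
Proof. by apply/permP => -[a b]; rewrite permM !flipE perm1. Qed.

Lemma flipV : flip^-1 = flip.
Proof. by apply: (mulgI flip); rewrite mulgV flipK. Qed.

Lemma flip_prodp s t : flip * prodp s t = prodp t s * flip.
Proof. by apply/permP => x; rewrite !permM !flipE !prodpE. Qed.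

(* For [G = banded] this is [H9], for [G = centred] it is [Hmm]. *)
Definition wreath (G : {set {perm 'I_9}}) (g : {perm cell}) : Prop :=
  exists s t (b : bool), [/\ s \in G, t \in G & g = prodp s t * flip ^+ b].

Lemma wreath_prodp (G : {group {perm 'I_9}}) s t :
  s \in G -> t \in G -> wreath G (prodp s t).
Proof. by move=> sG tG; exists s, t, false; rewrite expg0 mulg1. Qed.

Lemma prodp1 : prodp 1 1 = 1.
Proof. by apply/permP => -[a b]; rewrite prodpE !perm1. Qed.

Lemma wreath1 (G : {group {perm 'I_9}}) : wreath G 1.
Proof. by rewrite -prodp1; apply: wreath_prodp. Qed.

Lemma wreath_flip (G : {group {perm 'I_9}}) : wreath G flip.
Proof. by exists 1, 1, true; rewrite !group1 prodp1 mul1g. Qed.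

(** Passing [flip] across [prodp s' t'] swaps the two factors, and the powers of [flip] add modulo
    2. *)
Lemma wreathM (G : {group {perm 'I_9}}) g h :
  wreath G g -> wreath G h -> wreath G (g * h).
Proof.
move=> [s [t [b [sG tG ->]]]] [s' [t' [b' [sG' tG' ->]]]].
case: b; last first.
  by exists (s * s'), (t * t'), b'; rewrite !groupM // expg0 mulg1 mulgA prodpM.
exists (s * t'), (t * s'), (~~ b'); rewrite !groupM //; split=> //.
rewrite expg1 -!mulgA (mulgA flip) flip_prodp -!mulgA mulgA prodpM; congr (_ * _).
by case: b' => /=; rewrite ?expg1 ?expg0 ?flipK ?mulg1.
Qed.

Lemma wreathV (G : {group {perm 'I_9}}) g : wreath G g -> wreath G g^-1.
Proof.
move=> [s [t [b [sG tG ->]]]]; rewrite invMg; apply: wreathM.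
  by case: b; rewrite ?expg1 ?expg0 ?flipV ?invg1; [apply: wreath_flip|apply: wreath1].
by rewrite prodpV; apply: wreath_prodp; rewrite groupV.
Qed.

Definition banded : {set {perm 'I_9}} :=
  [set s : {perm 'I_9} | [forall i : 'I_9, forall j : 'I_9,
    (s i %/ 3 == s j %/ 3) == (i %/ 3 == j %/ 3)]].

Lemma bandedP (s : {perm 'I_9}) :
  reflect (forall i j : 'I_9, (s i %/ 3 == s j %/ 3) = (i %/ 3 == j %/ 3)) (s \in banded).
Proof.
rewrite inE; apply: (iffP forallP) => [h i j|h i]; first by move/forallP: (h i) => /(_ j)/eqP.
by apply/forallP => j; apply/eqP.
Qed.

Lemma banded_group_set : group_set banded.
Proof.
apply/group_setP; split=> [|s t /bandedP sb /bandedP tb].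
  by apply/bandedP => i j; rewrite !perm1.
by apply/bandedP => i j; rewrite !permM tb sb.
Qed.
Canonical banded_group := Group banded_group_set.

Definition centred : {set {perm 'I_9}} :=
  [set s : {perm 'I_9} in banded | [forall i : 'I_9, (s i %% 3 == 1%N) == (i %% 3 == 1%N)]].

Lemma centredP (s : {perm 'I_9}) :
  reflect (s \in banded /\ forall i : 'I_9, (s i %% 3 == 1%N) = (i %% 3 == 1%N)) (s \in centred).
Proof.
rewrite [s \in centred]inE; apply: (iffP andP) => -[sb h]; split=> //.
  by move=> i; move/forallP: h => /(_ i)/eqP.
by apply/forallP => i; apply/eqP.
Qed.

Lemma centred_group_set : group_set centred.
Proof.
apply/group_setP; split=> [|s t /centredP[sb sc] /centredP[tb tc]].
  by apply/centredP; split=> [|i]; rewrite ?group1 ?perm1.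
by apply/centredP; split=> [|i]; rewrite ?groupM ?permM ?tc ?sc.
Qed.
Canonical centred_group := Group centred_group_set.

Lemma flip_conjK g : g = flip * (flip * g * flip) * flip.
Proof. by rewrite !mulgA flipK mul1g -mulgA flipK mulg1. Qed.

Lemma flip_conjE g x : (flip * g * flip) x = ((g (x.2, x.1)).2, (g (x.2, x.1)).1).
Proof. by rewrite !permM !flipE. Qed.

(** Conjugation by the transposition reduces the generators acting on columns to those acting on
    rows. *)
Lemma flip_conj_band g : (flip * g * flip \in band_perms) = (g \in pillar_perms).
Proof.
rewrite !inE; apply/existsP/existsP => -[p /forallP h]; exists p; apply/forallP => x.
  by have := h (x.2, x.1); rewrite flip_conjE /= -surjective_pairing.
by rewrite flip_conjE; apply: h.
Qed.

Lemma flip_conj_rowinband g :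
  (flip * g * flip \in rowinband_perms) = (g \in colinpillar_perms).
Proof.
rewrite !inE; apply/existsP/existsP => -[a /existsP[p /forallP h]];
  exists a; apply/existsP; exists p; apply/forallP => x.
  by have := h (x.2, x.1); rewrite flip_conjE /= -surjective_pairing.
by rewrite flip_conjE; apply: h.
Qed.

(** The image row depends on the row alone, so the row permutation can be read off in column
    [ord0]. *)
Lemma row_perm_wreath (g : {perm cell}) : (forall x, (g x).2 = x.2) ->
    (forall x y : cell, x.1 = y.1 -> (g x).1 = (g y).1) ->
    (forall x y : cell, ((g x).1 %/ 3 == (g y).1 %/ 3) = (x.1 %/ 3 == y.1 %/ 3)) ->
  wreath banded g.
Proof.
move=> g2 g1 gb.
have hinj : injective (fun i => (g (i, ord0)).1).
  move=> i j e; have /(congr1 fst) //: (i, ord0) = (j, ord0) :> cell.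
  by apply: (@perm_inj _ g); apply: cell_eq; rewrite ?g2 ?e.
have -> : g = prodp (perm hinj) 1.
  apply/permP => x; rewrite prodpE perm1 permE.
  by apply: cell_eq; rewrite ?g2 //= (g1 x (x.1, ord0)).
by apply: wreath_prodp; rewrite ?group1 //; apply/bandedP => i j; rewrite !permE gb.
Qed.

Lemma band_wreath g : g \in band_perms -> wreath banded g.
Proof.
rewrite inE => /existsP[p /forallP h].
have h1 x : (g x).1 = (3 * p (inord (x.1 %/ 3)) + x.1 %% 3)%N :> nat.
  by have /andP[/eqP] := h x.
apply: row_perm_wreath => [x|x y e|x y]; first by have /andP[_ /eqP] := h x.
  by apply: val_inj; rewrite /= !h1 e.
have <- : (p (inord (x.1 %/ 3)) == p (inord (y.1 %/ 3)) :> nat) = (x.1 %/ 3 == y.1 %/ 3).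
  rewrite (inj_eq val_inj) (inj_eq perm_inj) -(inj_eq val_inj) /=.
  by rewrite !inordK // band_lt.
by rewrite !h1; lia.
Qed.

Lemma rowinband_wreath g : g \in rowinband_perms -> wreath banded g.
Proof.
rewrite inE => /existsP[a /existsP[p /forallP h]].
have h1 x : (g x).1 = (if x.1 %/ 3 == a then (3 * a + p (inord (x.1 %% 3)))%N else x.1) :> nat.
  by have /andP[] := h x; case: ifP => _ /eqP // ->.
apply: row_perm_wreath => [x|x y e|x y]; first by have /andP[_ /eqP] := h x.
  by apply: val_inj; rewrite /= !h1 e.
suff hb z : (g z).1 %/ 3 = z.1 %/ 3 by rewrite !hb.
by rewrite h1; case: eqP => // ->; have := ltn_ord (p (inord (z.1 %% 3))); lia.
Qed.

Lemma H9_gens_wreath g : g \in H9_gens -> wreath banded g.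
Proof.
rewrite !in_setU -flip_conj_band -flip_conj_rowinband => /orP[/orP[/orP[/orP[]|]|]|].
- exact: band_wreath.
- exact: rowinband_wreath.
- move=> /band_wreath h; rewrite (flip_conjK g).
  by do 2?apply: wreathM; rewrite //; apply: wreath_flip.
- move=> /rowinband_wreath h; rewrite (flip_conjK g).
  by do 2?apply: wreathM; rewrite //; apply: wreath_flip.
- rewrite inE => /forallP h; suff -> : g = flip by apply: wreath_flip.
  by apply/permP => x; rewrite flipE; apply/eqP.
Qed.

Lemma H9_wreath g : g \in H9 -> wreath banded g.
Proof.
move=> /gen_prodgP[n [c cG ->]]; apply: (big_ind (wreath banded)).
- exact: wreath1.
- exact: wreathM.
- by move=> i _; apply: H9_gens_wreath.
Qed.

Lemma gens_H9 g : g \in H9_gens -> g \in H9.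
Proof. exact: mem_gen. Qed.

Lemma flip_H9 : flip \in H9.
Proof.
apply: gens_H9; rewrite !in_setU; apply/orP; right.
by rewrite inE; apply/forallP => x; rewrite flipE.
Qed.

Lemma band_block_lt (a i : 'I_3) : 3 * a + i < 9.
Proof. by have := ltn_ord a; have := ltn_ord i; lia. Qed.

(** The positions within band [a] are permuted by [q], which exhibits the map as a single
    generator. *)
Lemma prodp_one_band (s : {perm 'I_9}) (a : 'I_3) :
    (forall i : 'I_9, s i %/ 3 = i %/ 3) -> (forall i : 'I_9, i %/ 3 != a -> s i = i) ->
  prodp s 1 \in H9.
Proof.
move=> sb sa; pose q (i : 'I_3) : 'I_3 := inord (s (inord (3 * a + i)) %% 3).
have qE (i : 'I_3) : (3 * a + q i)%N = s (inord (3 * a + i)) :> nat.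
  rewrite /q inordK ?ltn_mod // {2}(divn_eq (s _) 3) sb inordK ?band_block_lt //.
  by have := ltn_ord i; lia.
have qinj : injective q.
  move=> i j e; apply: val_inj; have := qE j; rewrite -e qE => /val_inj/perm_inj/(congr1 val).
  by rewrite /= !inordK ?band_block_lt //; lia.
apply: gens_H9; rewrite !in_setU -!orbA; apply/or4P; apply: Or42.
rewrite inE; apply/existsP; exists a; apply/existsP; exists (perm qinj).
apply/forallP => x; rewrite prodpE perm1 eqxx andbT /=.
case: eqP => [e|/eqP ne]; last by rewrite sa.
rewrite permE qE inordK ?ltn_mod // (_ : inord _ = x.1) //.
by apply: inord9; rewrite -e mulnC -divn_eq.
Qed.

(** Such an [s] is the product of its restrictions [h a] to the three bands, each extended by the
    identity. *)
Lemma prodp_fix_bands (s : {perm 'I_9}) :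
  (forall i : 'I_9, s i %/ 3 = i %/ 3) -> prodp s 1 \in H9.
Proof.
move=> sb; pose h (a : 'I_3) (i : 'I_9) := if i %/ 3 == a then s i else i.
have hb a i : h a i %/ 3 = i %/ 3 by rewrite /h; case: ifP.
have hinj a : injective (h a).
  move=> i j e; have := hb a i; rewrite e hb => ij; move: e.
  by rewrite /h ij; case: ifP => // _ /perm_inj.
have -> : prodp s 1 = prodp (perm (@hinj (inord 0))) 1 * prodp (perm (@hinj (inord 1))) 1
                      * prodp (perm (@hinj (inord 2))) 1.
  rewrite !prodpM !mulg1; congr (prodp _ _); apply/permP => i.
  rewrite !permM !permE /h !inordK //.
  have : i %/ 3 < 3 by exact: band_lt.
  by case E: (i %/ 3) => [|[|[|]]] //= _; rewrite ?E ?sb ?E /= ?sb ?E.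
have hH a : prodp (perm (@hinj a)) 1 \in H9.
  by apply: (prodp_one_band (a := a)) => i; rewrite permE ?hb // /h => /negbTE->.
by rewrite !groupM.
Qed.

(** Factor [s] as [P], which moves whole bands and keeps positions within them, followed by [s'],
    which fixes every band. The band permutation [q] is read off from the top row of each band. *)
Lemma prodp_row_H9 s : s \in banded -> prodp s 1 \in H9.
Proof.
move=> /bandedP sb; pose q (a : 'I_3) : 'I_3 := inord (s (inord (3 * a)) %/ 3).
have a9 (a : 'I_3) : 3 * a < 9 by have := ltn_ord a; lia.
have qE (i : 'I_9) : q (inord (i %/ 3)) = s i %/ 3 :> nat.
  rewrite /q inordK ?band_lt //; apply/eqP; rewrite sb inordK ?mulKn //.
  by rewrite inordK ?band_lt.
have qinj : injective q.
  move=> a b e; apply: val_inj; move: (congr1 val e); rewrite /q /= !inordK ?band_lt // => /eqP.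
  by rewrite sb !inordK // => /eqP; lia.
pose P (i : 'I_9) : 'I_9 := inord (3 * q (inord (i %/ 3)) + i %% 3).
have PE (i : 'I_9) : P i = (3 * q (inord (i %/ 3)) + i %% 3)%N :> nat.
  by rewrite /P inordK // qE; have := band_lt (s i); lia.
have Pinj : injective P.
  move=> i j e; have := PE i; rewrite e PE !qE => {}e.
  have /eqP : s i %/ 3 == s j %/ 3 by apply/eqP; lia.
  move/eqP; rewrite sb => /eqP ij; apply: val_inj => /=; lia.
pose s' := (perm Pinj)^-1 * s.
have -> : prodp s 1 = prodp (perm Pinj) 1 * prodp s' 1.
  by rewrite prodpM mulg1 mulKVg.
rewrite groupM //.
  apply: gens_H9; rewrite !in_setU -!orbA; apply/or4P; apply: Or41.
  rewrite inE; apply/existsP; exists (perm qinj); apply/forallP => x.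
  by rewrite prodpE !permE eqxx andbT /= PE.
apply: prodp_fix_bands => i; rewrite /s' permM.
have := PE ((perm Pinj)^-1 i); rewrite -[P _](permE Pinj) permKV => ->.
by rewrite qE; lia.
Qed.

Lemma prodp_H9 s t : s \in banded -> t \in banded -> prodp s t \in H9.
Proof.
move=> sb tb; have -> : prodp s t = prodp s 1 * (flip * prodp t 1 * flip).
  by rewrite flip_prodp -mulgA flipK mulg1 prodpM mulg1 mul1g.
by rewrite !groupM ?prodp_row_H9 ?flip_H9.
Qed.

Lemma wreath_H9 g : wreath banded g -> g \in H9.
Proof. by move=> [s [t [b [sb tb ->]]]]; rewrite groupM ?groupX ?prodp_H9 ?flip_H9. Qed.

(** * The action on boards, and which symmetries preserve the Sudoku and magic conditions *)

Lemma bactM g h B : bact (g * h) B = bact h (bact g B).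
Proof. by apply/ffunP => x; rewrite !ffunE invMg permM. Qed.

Lemma bact_prodp s t B r c : bact (prodp s t) B (r, c) = B (s^-1 r, t^-1 c).
Proof. by rewrite ffunE prodpV prodpE. Qed.

Lemma bact_flip B r c : bact flip B (r, c) = B (c, r).
Proof. by rewrite ffunE flipV flipE. Qed.

Lemma sudokuP (B : board) : reflect
  [/\ forall r k : 'I_9, #|[set c : 'I_9 | B (r, c) == k]| = 1%N,
      forall c k : 'I_9, #|[set r : 'I_9 | B (r, c) == k]| = 1%N &
      forall (a b : 'I_3) (k : 'I_9),
        #|[set x : cell | (x.1 %/ 3 == a) && (x.2 %/ 3 == b) && (B x == k)]| = 1%N]
  (sudoku B).
Proof.
apply: (iffP andP) => [[/andP[h1 h2] h3]|[h1 h2 h3]]; split.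
- by move=> r k; have /forallP/(_ k)/eqP := forallP h1 r.
- by move=> r k; have /forallP/(_ k)/eqP := forallP h2 r.
- by move=> a b k; have /forallP/(_ b)/forallP/(_ k)/eqP := forallP h3 a.
- by apply/andP; split; apply/forallP => r; apply/forallP => k; apply/eqP.
- by apply/forallP => a; apply/forallP => b; apply/forallP => k; apply/eqP.
Qed.

Lemma sudoku_flip B : sudoku B -> sudoku (bact flip B).
Proof.
move=> /sudokuP[h1 h2 h3]; apply/sudokuP; split.
- by move=> r k; rewrite -[RHS](h2 r k); apply: eq_card => c; rewrite !inE bact_flip.
- by move=> r k; rewrite -[RHS](h1 r k); apply: eq_card => c; rewrite !inE bact_flip.
move=> a b k; rewrite -[RHS](h3 b a k) -[RHS](card_imset _ (@perm_inj _ flip)).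
apply: eq_card => -[r c]; apply/idP/imsetP => [|[[r' c'] + ->]].
  rewrite inE /= bact_flip => h; exists (c, r); rewrite ?flipE // inE /=.
  by rewrite [X in X && _]andbC.
by rewrite !inE flipE /= bact_flip [X in X && _]andbC.
Qed.

Lemma banded_band (s : {perm 'I_9}) (a : 'I_3) : s \in banded ->
  exists b : 'I_3, forall i : 'I_9, (s i %/ 3 == b) = (i %/ 3 == a).
Proof.
move=> /bandedP sb; exists (inord (s (inord (3 * a)) %/ 3)) => i.
rewrite inordK ?band_lt // sb inordK; last by have := ltn_ord a; lia.
by rewrite mulnC mulnK.
Qed.

(** The cells of a row, column or block of the moved board that hold [k] are the preimage, under the
    inverse permutation, of such a set for [B]; hence the initial passage to inverses. *)
Lemma sudoku_prodp s t B :
  s \in banded -> t \in banded -> sudoku B -> sudoku (bact (prodp s t) B).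
Proof.
rewrite -groupV => sb; rewrite -groupV => tb /sudokuP[h1 h2 h3]; apply/sudokuP; split.
- move=> r k; rewrite -[RHS](h1 (s^-1 r) k) -[RHS](card_preimset _ (@perm_inj _ t^-1)).
  by apply: eq_card => c; rewrite !inE bact_prodp.
- move=> c k; rewrite -[RHS](h2 (t^-1 c) k) -[RHS](card_preimset _ (@perm_inj _ s^-1)).
  by apply: eq_card => r; rewrite !inE bact_prodp.
move=> a b k; have [a' ha] := banded_band a sb; have [b' hb] := banded_band b tb.
rewrite -[RHS](h3 a' b' k) -[RHS](card_preimset _ (@perm_inj _ (prodp s^-1 t^-1))).
by apply: eq_card => -[r c]; rewrite !inE bact_prodp prodpE /= ha hb.
Qed.

Definition at_nat (B : board) (r c : nat) : nat := B (inord r, inord c).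

Definition block_val (B : board) (a b k : nat) : nat :=
  at_nat B (3 * a + k %/ 3) (3 * b + k %% 3).

Lemma forall_ord3 (P : pred 'I_3) :
  [forall i, P i] = [&& P (inord 0), P (inord 1) & P (inord 2)].
Proof.
apply/forallP/and3P => [h|[h0 h1 h2] i]; first by split.
by rewrite -(inord_val i); case: i => [[|[|[|]]]].
Qed.

Lemma sum_ord3 (F : 'I_3 -> nat) : (\sum_i F i = F (inord 0) + F (inord 1) + F (inord 2))%N.
Proof.
rewrite !big_ord_recl big_ord0 addn0 addnA.
by congr (F _ + F _ + F _)%N; apply: val_inj; rewrite /= inordK.
Qed.

Lemma modmagicE B : modmagic B =
  [forall a : 'I_3, forall b : 'I_3,
    all (fun l => 9 %| block_val B a b l.1.1 + block_val B a b l.1.2 + block_val B a b l.2)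
      block_lines].
Proof.
apply: eq_forallb => a; apply: eq_forallb => b.
rewrite !forall_ord3 !sum_ord3 /bcell !inordK //=.
(* [block_lines] lists the lines in the order used by [modmagic], so only the bracketing of the
   conjunction differs. *)
by rewrite -!andbA andbT.
Qed.

Lemma modmagicP B : reflect
  (forall (a b : 'I_3) l, l \in block_lines ->
    9 %| block_val B a b l.1.1 + block_val B a b l.1.2 + block_val B a b l.2)
  (modmagic B).
Proof.
rewrite modmagicE; apply: (iffP forallP) => [h a b|h a].
  by apply/allP; have /forallP/(_ b) := h a.
by apply/forallP => b; apply/allP; apply: h.
Qed.

(** A symmetry of the block carries each listed line to a listed line, traversed either forwards or
    backwards; both readings are tried. *)
Ltac by_block_line hb :=
  match goal with
  |- is_true (_ %| block_val _ _ _ ?i + block_val _ _ _ ?j + block_val _ _ _ ?k) =>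
    let i' := eval compute in i in
    let j' := eval compute in j in
    let k' := eval compute in k in
    first [ exact: (hb (i', j', k'))
          | rewrite addnC (addnC (block_val _ _ _ i)) addnA; exact: (hb (k', j', i')) ]
  end.

Lemma modmagic_flip B : modmagic B -> modmagic (bact flip B).
Proof.
move=> /modmagicP h; apply/modmagicP => a b l.
have fE k : k < 9 -> block_val (bact flip B) a b k = block_val B b a (3 * (k %% 3) + k %/ 3).
  move=> k9; rewrite /block_val /at_nat bact_flip; congr (val (B (inord _, inord _))); lia.
rewrite /block_lines !inE => /or4P[|||/or4P[|||/orP[]]] /eqP-> /=; rewrite !fE //;
  by_block_line (h b a).
Qed.

Definition mirror (e : bool) (i : nat) : nat := if e then 2 - i else i.

(** The band goes onto a band and its middle row onto the middle row, so the two outer rows are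
    either kept in order or exchanged. *)
Lemma centred_band (s : {perm 'I_9}) (a : 'I_3) : s \in centred ->
  exists (b : 'I_3) (e : bool), forall i, i < 3 ->
    s (inord (3 * a + i)) = inord (3 * b + mirror e i).
Proof.
move=> /centredP[/bandedP sb sc].
pose x i : 'I_9 := inord (3 * a + i).
have xE i : i < 3 -> x i = (3 * a + i)%N :> nat.
  by move=> i3; rewrite /x inordK //; have := ltn_ord a; lia.
have sE i : i < 3 -> s (x i) = (3 * (s (x 0) %/ 3) + s (x i) %% 3)%N :> nat.
  move=> i3; have /eqP <- : s (x i) %/ 3 == s (x 0) %/ 3 by rewrite sb !xE //; apply/eqP; lia.
  lia.
have sI i j : i < 3 -> j < 3 -> s (x i) = s (x j) :> nat -> i = j.
  by move=> i3 j3 /val_inj/perm_inj/(congr1 val) /=; rewrite !xE //; lia.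
have c i : i < 3 -> (s (x i) %% 3 == 1%N) = (i == 1%N).
  by move=> i3; rewrite sc xE //; lia.
(* The image of the first row of the band decides both the target band and whether it is
   reversed. *)
exists (inord (s (x 0) %/ 3)), (s (x 0) %% 3 == 2%N) => i i3.
rewrite -[inord (3 * a + i)]/(x i) inordK ?band_lt //; apply/esym/inord9; rewrite /mirror.
have := sI 0 2 isT isT; have := sE 0 isT; have := sE 1%N isT; have := sE 2%N isT.
have := c 0 isT; have := c 1%N isT; have := c 2%N isT.
case: i i3 => [|[|[|//]]] _; case: ifP; lia.
Qed.

Lemma modmagic_prodp s t B :
  s \in centred -> t \in centred -> modmagic B -> modmagic (bact (prodp s t) B).
Proof.
rewrite -groupV => sc; rewrite -groupV => tc /modmagicP h; apply/modmagicP => a b l.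
have [a' [e sE]] := centred_band a sc; have [b' [f tE]] := centred_band b tc.
have fE k : k < 9 -> block_val (bact (prodp s t) B) a b k =
    block_val B a' b' (3 * mirror e (k %/ 3) + mirror f (k %% 3)).
  move=> k9; rewrite /block_val /at_nat bact_prodp sE ?tE; [|lia|lia].
  by congr (val (B (inord _, inord _))); rewrite /mirror; case: (e); case: (f); lia.
rewrite /block_lines !inE => /or4P[|||/or4P[|||/orP[]]] /eqP->; rewrite !fE //= /mirror;
  case: (e); case: (f); by_block_line (h a' b').
Qed.

Lemma mmboard_flip B : mmboard B -> mmboard (bact flip B).
Proof. by case/andP=> *; rewrite /mmboard sudoku_flip ?modmagic_flip. Qed.

Lemma centred_banded s : s \in centred -> s \in banded.
Proof. by case/centredP. Qed.

Lemma mmboard_prodp s t B :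
  s \in centred -> t \in centred -> mmboard B -> mmboard (bact (prodp s t) B).
Proof.
by move=> sc tc /andP[? ?]; rewrite /mmboard sudoku_prodp ?modmagic_prodp ?centred_banded.
Qed.

Lemma mmboard_wreath g B : wreath centred g -> mmboard B -> mmboard (bact g B).
Proof.
move=> [s [t [b [sc tc ->]]]] mB; rewrite bactM.
case: b; first by rewrite expg1; apply/mmboard_flip/mmboard_prodp.
have -> C : bact (flip ^+ false) C = C.
  by apply/ffunP => x; rewrite expg0 ffunE invg1 perm1.
exact: mmboard_prodp.
Qed.

(** Centred permutations act on each block by reflections, which permute its rows, its columns and
    its diagonals. *)
Lemma wreath_Hmm g : wreath centred g -> g \in Hmm.
Proof.
move=> wg; rewrite inE; apply/andP; split.
  case: wg => s [t [b [sc tc ->]]]; apply: wreath_H9; exists s, t, b.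
  by rewrite !centred_banded.
by apply/forallP => B; apply/implyP; apply: mmboard_wreath.
Qed.

(** * Multiples of 3 in a modular-magic board *)

Lemma card1_inj (T : finType) (A : {set T}) x y : #|A| = 1%N -> x \in A -> y \in A -> x = y.
Proof. by move=> /eqP/cards1P[z ->]; rewrite !inE => /eqP-> /eqP->. Qed.

Lemma mmboard_block_inj (B : board) (x y : cell) : mmboard B ->
  x.1 %/ 3 = y.1 %/ 3 -> x.2 %/ 3 = y.2 %/ 3 -> B x = B y -> x = y.
Proof.
move=> /andP[/sudokuP[_ _ h] _] e1 e2 e.
by apply: (card1_inj (h (inord (x.1 %/ 3)) (inord (x.2 %/ 3)) (B x)));
  rewrite inE !inordK ?band_lt // ?e1 ?e2 ?e !eqxx.
Qed.

Lemma mmboard_row_inj (B : board) r c c' : mmboard B -> B (r, c) = B (r, c') -> c = c'.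
Proof.
by move=> /andP[/sudokuP[h _ _] _] e; apply: (card1_inj (h r (B (r, c)))); rewrite inE ?e.
Qed.

Lemma mmboard_col_inj (B : board) r r' c : mmboard B -> B (r, c) = B (r', c) -> r = r'.
Proof.
by move=> /andP[/sudokuP[_ h _] _] e; apply: (card1_inj (h c (B (r, c)))); rewrite inE ?e.
Qed.

Lemma mmboard_row_surj (B : board) r (k : 'I_9) : mmboard B -> exists c, B (r, c) = k.
Proof.
move=> /andP[/sudokuP[h _ _] _]; have /eqP/cards1P[c /setP/(_ c)] := h r k.
by rewrite !inE eqxx => /eqP; exists c.
Qed.

Lemma block_val_bound B a b k : block_val B a b k < 9.
Proof. exact: ltn_ord. Qed.

Lemma block_valE (B : board) (r c : 'I_9) :
  B (r, c) = block_val B (r %/ 3) (c %/ 3) (3 * (r %% 3) + c %% 3) :> nat.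
Proof.
by rewrite /block_val /at_nat; congr (val (B (_, _))); apply/esym/inord9; lia.
Qed.

Lemma mmboard_block_val_inj B (a b : 'I_3) i k : mmboard B -> i < 9 -> k < 9 ->
  block_val B a b i = block_val B a b k -> i = k.
Proof.
move=> mB i9 k9 /val_inj/(mmboard_block_inj mB).
have ha := ltn_ord a; have hb := ltn_ord b.
rewrite /= !inordK; try lia.
move=> h; have e := h ltac:(lia) ltac:(lia).
have := congr1 (fun x : cell => x.1 : nat) e; have := congr1 (fun x : cell => x.2 : nat) e.
by rewrite /= !inordK; lia.
Qed.

Lemma mem_magic_blocks B (a b : 'I_3) : mmboard B ->
  prefix_stack (block_val B a b) 9 \in magic_blocks.
Proof.
move=> mB; apply: mem_search => [k _|k i k9|l ll _].
- by rewrite mem_iota block_val_bound.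
- rewrite mem_iota => /= ik; split=> // e.
  by have := mmboard_block_val_inj mB (ltn_trans ik k9) k9 e; lia.
- have [_ /modmagicP h] := andP mB; split; last exact: h.
  all: by move: l ll; apply/allP.
Qed.

(** Index [d] of the stack holds position [8 - d] of the block. For the centre [x] there is a direct
    reason: the four lines through it add up to [36 + 3 * x], so 9 divides [3 * x]. *)
Lemma magic_blocks_thirds :
  all (fun s => [&& 3 %| nth 0 s 4, ~~ (3 %| nth 0 s 7), ~~ (3 %| nth 0 s 1),
                    ~~ ((3 %| nth 0 s 8) && (3 %| nth 0 s 6)) &
                    ~~ ((3 %| nth 0 s 2) && (3 %| nth 0 s 0))]) magic_blocks.
Proof. by vm_compute. Qed.

Lemma block_val_thirds B (a b : 'I_3) : mmboard B ->
  let x := block_val B a b in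
  [/\ 3 %| x 4, ~~ (3 %| x 1%N), ~~ (3 %| x 7),
      ~~ ((3 %| x 0) && (3 %| x 2)) & ~~ ((3 %| x 6) && (3 %| x 8))].
Proof.
by move=> mB; have /and5P[] := allP magic_blocks_thirds _ (mem_magic_blocks a b mB).
Qed.

Lemma mmboard_centre (B : board) (r c : 'I_9) : mmboard B ->
  r %% 3 = 1%N -> c %% 3 = 1%N -> 3 %| B (r, c).
Proof.
move=> mB r1 c1; have [] := block_val_thirds (inord (r %/ 3)) (inord (c %/ 3)) mB.
by rewrite block_valE !inordK ?band_lt // r1 c1.
Qed.

(** In an outer row of a block the middle cell is an edge cell, never a multiple of 3, and the two
    corners are not both multiples of 3. *)
Lemma mmboard_row_thirds (B : board) (r c : 'I_9) : mmboard B ->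
    r %% 3 != 1%N -> 3 %| B (r, c) ->
  c %% 3 != 1%N /\ forall c' : 'I_9, c' %/ 3 = c %/ 3 -> 3 %| B (r, c') -> c' = c.
Proof.
move=> mB r1 d3; have := block_val_thirds (inord (r %/ 3)) (inord (c %/ 3)) mB.
rewrite !inordK ?band_lt //= => -[_ n1 n7 n02 n68].
have r02 : r %% 3 = 0 \/ r %% 3 = 2 by have := ltn_pmod r (isT : 0 < 3); lia.
have mid (j : 'I_9) : j %/ 3 = c %/ 3 -> 3 %| B (r, j) -> j %% 3 != 1%N.
  rewrite block_valE => -> ; case: (j %% 3 =P 1%N) => // ->.
  by case: r02 => ->; apply: contraLR.
split=> [|c' ec d3']; first exact: mid.
have := mid _ ec d3'; have := mid _ erefl d3.
move: d3 d3'; rewrite !block_valE ec => d3 d3' m m'.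
apply: val_inj => /=; rewrite (divn_eq c' 3) (divn_eq c 3) ec; congr (_ + _)%N.
have h : c %% 3 = 0 \/ c %% 3 = 2 by have := ltn_pmod c (isT : 0 < 3); lia.
have h' : c' %% 3 = 0 \/ c' %% 3 = 2 by have := ltn_pmod c' (isT : 0 < 3); lia.
move: d3 d3' n02 n68.
by case: r02 => ->; case: h => ->; case: h' => -> //= -> ->.
Qed.

Definition reflect_col (i : 'I_9) : 'I_9 := inord (3 * (i %/ 3) + (2 - i %% 3)).

Lemma reflect_colE i : reflect_col i = (3 * (i %/ 3) + (2 - i %% 3))%N :> nat.
Proof. by rewrite inordK //; have := ltn_ord i; lia. Qed.

Lemma reflect_col_inj : injective reflect_col.
Proof.
by move=> i j /(congr1 val); rewrite /= !reflect_colE => e; apply: val_inj => /=; lia.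
Qed.

Lemma reflect_col_centred : perm reflect_col_inj \in centred.
Proof.
apply/centredP; split=> [|i]; last by rewrite permE reflect_colE; lia.
by apply/bandedP => i j; rewrite !permE !reflect_colE; lia.
Qed.

(* A corner would be a multiple of 3 both before and after reflecting all pillars. *)
Lemma always_third_row (B0 : board) (r c : 'I_9) : mmboard B0 ->
    (forall B : board, mmboard B -> 3 %| B (r, c)) -> r %% 3 = 1%N.
Proof.
move=> mB0 h; apply/eqP; apply/idPn => r1.
have [c1 cU] := mmboard_row_thirds mB0 r1 (h _ mB0).
have w : (perm reflect_col_inj)^-1 \in centred by rewrite groupV reflect_col_centred.
have := h _ (mmboard_prodp (group1 _) w mB0).
rewrite bact_prodp invgK invg1 perm1 permE => /cU e.
by have := congr1 val (e _); rewrite /= reflect_colE; lia.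
Qed.

Lemma always_third_col (B0 : board) (r c : 'I_9) : mmboard B0 ->
    (forall B : board, mmboard B -> 3 %| B (r, c)) -> c %% 3 = 1%N.
Proof.
move=> mB0 h; apply: (@always_third_row B0 c r) => // B mB.
by have := h _ (mmboard_flip mB); rewrite bact_flip.
Qed.

(** The converse implication follows because each band has a single middle row: if [s i] is a middle
    row, it coincides with the image of the middle row of the band of [i]. *)
Lemma banded_centred s : s \in banded ->
  (forall i : 'I_9, i %% 3 = 1%N -> s i %% 3 = 1%N) -> s \in centred.
Proof.
move=> sb h; apply/centredP; split=> // i; apply/eqP/eqP => [si|]; last exact: h.
pose j : 'I_9 := inord (3 * (i %/ 3) + 1).
have jE : j = (3 * (i %/ 3) + 1)%N :> nat by rewrite inordK //; have := band_lt i; lia.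
have sj : s j %% 3 = 1%N by apply: h; rewrite jE; lia.
have /eqP e : s i %/ 3 == s j %/ 3 by rewrite (bandedP _ sb) jE; apply/eqP; lia.
have /perm_inj -> : s i = s j by apply: val_inj => /=; lia.
by rewrite jE; lia.
Qed.

(** Centres of the moved board are multiples of 3 for every [B], so the preimage of a centre always
    holds a multiple of 3 and must itself be a centre. The board [B0] keeps the preservation
    condition from being vacuous. *)
Lemma Hmm_wreath (B0 : board) g : mmboard B0 -> g \in Hmm -> wreath centred g.
Proof.
move=> mB0; rewrite inE => /andP[/H9_wreath[s [t [b [sb tb ->]]]] /forallP pg].
(* Transposition preserves modular-magic boards, so it can be cancelled. *)
have pst (B : board) : mmboard B -> mmboard (bact (prodp s t) B).
  move=> mB; have := implyP (pg B) mB; rewrite bactM; case: b {pg} => [|h].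
    by rewrite expg1 => /mmboard_flip; rewrite -bactM flipK -bactM mulg1.
  by move: h; rewrite -bactM mulg1.
have pc (r c : 'I_9) : r %% 3 = 1%N -> c %% 3 = 1%N ->
    forall B : board, mmboard B -> 3 %| B (s^-1 r, t^-1 c).
  by move=> r1 c1 B /pst mB; rewrite -bact_prodp; apply: mmboard_centre.
(* To test one coordinate, the other is held at the middle line with index 1. *)
have m1 : (inord 1 : 'I_9) %% 3 = 1%N by rewrite inordK.
exists s, t, b; split=> //.
  rewrite -groupV; apply: banded_centred; rewrite ?groupV // => i i1.
  exact: always_third_row mB0 (pc _ _ i1 m1).
rewrite -groupV; apply: banded_centred; rewrite ?groupV // => i i1.
exact: always_third_col mB0 (pc _ _ m1 i1).
Qed.

(** * Normal forms *)

Definition code_ok (u : seq nat) : bool :=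
  all (fun i => nth 0 u i < 9) (iota 0 9) &&
  all (fun i => eqn (nth 0 u i %% 3) 1 == eqn (i %% 3) 1 :> bool) (iota 0 9) &&
  all (fun i => all (fun j =>
    (eqn (nth 0 u i) (nth 0 u j) == eqn i j) &&
    (eqn (nth 0 u i %/ 3) (nth 0 u j %/ 3) == eqn (i %/ 3) (j %/ 3))) (iota 0 9)) (iota 0 9).

Lemma centred_codes_ok : all code_ok centred_codes.
Proof. by vm_compute. Qed.

Lemma short_codes_centred : all (mem centred_codes) short_codes.
Proof. by vm_compute. Qed.

Lemma mem_iota9 (i : 'I_9) : (i : nat) \in iota 0 9.
Proof. by rewrite mem_iota /=. Qed.

Lemma code_centred u : u \in centred_codes ->
  exists2 s : {perm 'I_9}, s \in centred & forall i : 'I_9, s i = nth 0 u i :> nat.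
Proof.
move=> /(allP centred_codes_ok)/andP[/andP[/allP lt9 /allP mid] /allP pairs].
pose f (i : 'I_9) : 'I_9 := inord (nth 0 u i).
have fE i : f i = nth 0 u i :> nat by rewrite inordK // lt9 ?mem_iota9.
have pr (i j : 'I_9) := andP (allP (pairs i (mem_iota9 i)) j (mem_iota9 j)).
have finj : injective f.
  move=> i j /(congr1 val); rewrite /= !fE => /eqP e.
  by have [/eqP h _] := pr i j; apply/val_inj/eqP; rewrite -eqnE -h eqnE.
exists (perm finj) => [|i]; last by rewrite permE.
apply/centredP; split=> [|i]; last by rewrite permE fE; have /eqP := mid i (mem_iota9 i).
by apply/bandedP => i j; rewrite !permE !fE; have [_ /eqP] := pr i j.
Qed.

Definition perm_code (s : {perm 'I_9}) : seq nat := [seq (s (inord i) : nat) | i <- iota 0 9].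

Lemma nth_perm_code s (i : 'I_9) : nth 0 (perm_code s) i = s i.
Proof. by rewrite (nth_map 0) ?size_iota // nth_iota // inord_val. Qed.

(** By [centred_band] each band contributes one of [centred_triples], so the finite check in [rigid]
    covers every element of [centred]. *)
Lemma centred_perm_code s : s \in centred -> perm_code s \in centred_codes.
Proof.
move=> sc; rewrite mem_filter; apply/andP; split.
  rewrite map_inj_in_uniq ?iota_uniq // => i j.
  rewrite !mem_iota => /andP[_ i9] /andP[_ j9] /val_inj/perm_inj/(congr1 val).
  by rewrite /= !inordK.
have tri (a : 'I_3) : [seq (s (inord (3 * a + i)) : nat) | i <- iota 0 3] \in centred_triples.
  have [b [e h]] := centred_band a sc.
  rewrite /= !h // !inordK; try by have := ltn_ord b; rewrite /mirror; case: (e); lia.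
  by case: b {h} => [[|[|[|]]]] //= _; case: e.
have := tri (inord 0); have := tri (inord 1); have := tri (inord 2).
rewrite !inordK // => t2 t1 t0.
exact: (allpairs_f _ t0 (allpairs_f _ t1 t2)).
Qed.

(** Bands can be permuted freely and reflected independently, so their first lines can be sent to
    any outer lines of three distinct bands. *)
Lemma placement_check :
  all (fun x => all (fun y => all (fun z =>
    if [|| eqn (x %% 3) 1, eqn (y %% 3) 1, eqn (z %% 3) 1, eqn (x %/ 3) (y %/ 3),
           eqn (x %/ 3) (z %/ 3) | eqn (y %/ 3) (z %/ 3)] then true
    else has (fun u => [&& eqn (nth 0 u 0) x, eqn (nth 0 u 3) y & eqn (nth 0 u 6) z])
           centred_codes) (iota 0 9)) (iota 0 9)) (iota 0 9).
Proof. by vm_compute. Qed.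

Lemma centred_placement (x y z : 'I_9) :
    x %% 3 != 1%N -> y %% 3 != 1%N -> z %% 3 != 1%N ->
    x %/ 3 != y %/ 3 -> x %/ 3 != z %/ 3 -> y %/ 3 != z %/ 3 ->
  exists2 s : {perm 'I_9}, s \in centred &
    [/\ s (inord 0) = x, s (inord 3) = y & s (inord 6) = z].
Proof.
move=> x1 y1 z1 xy xz yz.
have /allP/(_ _ (mem_iota9 y))/allP/(_ _ (mem_iota9 z)) := allP placement_check _ (mem_iota9 x).
case: ifP => [|_ /hasP[u /code_centred[s sc su]]]; last first.
  rewrite !eqnE => /and3P[/eqP e0 /eqP e3 /eqP e6].
  by exists s => //; split; apply: val_inj; rewrite /= su inordK.
by rewrite !eqnE (negbTE x1) (negbTE y1) (negbTE z1) (negbTE xy) (negbTE xz) (negbTE yz).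
Qed.

(** Along an outer row the entries 0, 3, 6 lie in outer columns, and no two of them share a pillar,
    so [centred_placement] applies. *)
Lemma align_row (B : board) (r : 'I_9) : mmboard B -> r %% 3 != 1%N ->
  exists2 t : {perm 'I_9}, t \in centred &
    forall k, k < 3 -> B (r, t (inord (3 * k))) = (3 * k)%N :> nat.
Proof.
move=> mB r1.
have ex k : k < 3 -> exists2 c, B (r, c) = (3 * k)%N :> nat & 3 %| B (r, c).
  move=> k3; have [c ce] := mmboard_row_surj r (inord (3 * k)) mB.
  have cE : B (r, c) = (3 * k)%N :> nat by rewrite ce inordK //; lia.
  by exists c; rewrite ?cE ?dvdn_mulr.
have [x xE x3] := ex 0 isT; have [y yE y3] := ex 1%N isT; have [z zE z3] := ex 2 isT.
have [x1 xU] := mmboard_row_thirds mB r1 x3.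
have [y1 yU] := mmboard_row_thirds mB r1 y3.
have [z1 zU] := mmboard_row_thirds mB r1 z3.
have [|||t tc [t0 t3 t6]] := centred_placement x1 y1 z1.
- by apply/eqP => e; move: xE; rewrite (yU x e x3) yE.
- by apply/eqP => e; move: xE; rewrite (zU x e x3) zE.
- by apply/eqP => e; move: yE; rewrite (zU y e y3) zE.
exists t => // k; case: k => [|[|[|]]] // _; rewrite ?muln0 ?muln1.
- by rewrite t0.
- by rewrite t3.
- by rewrite (_ : 3 * 2 = 6)%N // t6.
Qed.

(** These are the cells prescribed by [board_alph]; the top left cell occurs in both conditions for
    [k = 0]. *)
Definition aligned (B : board) : Prop := forall k, k < 3 ->
  at_nat B 0 (3 * k) = (3 * k)%N /\ at_nat B (3 * k) 0 = (3 * k)%N.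

Lemma align (B : board) : mmboard B ->
  exists g, [/\ wreath centred g, mmboard (bact g B) & aligned (bact g B)].
Proof.
move=> mB; have [|t tc tE] := align_row (r := inord 0) mB; first by rewrite inordK.
have [|s sc sE] := align_row (r := t (inord 0)) (mmboard_flip mB).
  by have [_ ->] := centredP _ tc; rewrite inordK.
have {}sE k : k < 3 -> B (s (inord (3 * k)), t (inord 0)) = (3 * k)%N :> nat.
  by move=> /sE; rewrite bact_flip.
(* Both alignments put 0 at the corner, and 0 occurs once in that column. Hence [s] fixes the first
   row and the second alignment does not spoil the first. *)
have s0 : s (inord 0) = inord 0.
  apply: (mmboard_col_inj (c := t (inord 0)) mB); apply: val_inj => /=.
  by rewrite (sE 0) // (tE 0).
have w : wreath centred (prodp s^-1 t^-1) by apply: wreath_prodp; rewrite groupV.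
exists (prodp s^-1 t^-1); split=> //; first exact: mmboard_wreath.
by move=> k k3; rewrite /at_nat !bact_prodp !invgK s0 tE // sE.
Qed.

(** * Aligned boards as solutions of the search, and transfer of the finite checks *)

Definition pos_val (B : board) (p : nat) : nat := at_nat B (pos_row p) (pos_col p).

Lemma pos_val_block B q k : k < 9 -> pos_val B (9 * q + k) = block_val B (q %/ 3) (q %% 3) k.
Proof.
move=> k9; rewrite /pos_val /block_val /pos_row /pos_col.
by congr at_nat; congr (_ + _)%N; [congr (_ * _)%N| |congr (_ * _)%N|]; lia.
Qed.

Lemma at_nat_row_inj B r c c' : mmboard B -> c < 9 -> c' < 9 ->
  at_nat B r c = at_nat B r c' -> c = c'.
Proof.
by move=> mB c9 c9' /val_inj/(mmboard_row_inj mB)/(congr1 val); rewrite /= !inordK.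
Qed.

Lemma at_nat_col_inj B r r' c : mmboard B -> r < 9 -> r' < 9 ->
  at_nat B r c = at_nat B r' c -> r = r'.
Proof.
by move=> mB r9 r9' /val_inj/(mmboard_col_inj mB)/(congr1 val); rewrite /= !inordK.
Qed.

Lemma aligned_solution B : mmboard B -> aligned B ->
  prefix_stack (pos_val B) 81 \in solutions.
Proof.
move=> mB aB; apply: mem_search => [p _|p i p81|].
- have [a0 b0] := aB 0 isT; have [a1 b1] := aB 1%N isT; have [a2 b2] := aB 2 isT.
  rewrite /board_alph !eqnE; do 5?case: eqP => [->|_]; rewrite ?mem_seq1.
  + exact/eqP.
  + exact/eqP.
  + exact/eqP.
  + exact/eqP.
  + exact/eqP.
  + by rewrite mem_iota /= ltn_ord.
- rewrite mem_filter mem_iota => /andP[peer /= ip]; split=> // e.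
  (* A position is recovered from its row and column, so distinct positions in one row have distinct
     columns, and conversely. *)
  have q9 j : j < 81 -> [/\ pos_row j < 9, pos_col j < 9 &
      j = 27 * (pos_row j %/ 3) + 9 * (pos_col j %/ 3) + 3 * (pos_row j %% 3)
          + pos_col j %% 3]%N.
    by rewrite /pos_row /pos_col => j81; split; lia.
  have i81 := ltn_trans ip p81.
  have [ri ci ei] := q9 i i81; have [rp cp ep] := q9 p p81.
  move: peer; rewrite !eqnE => /or3P[/eqP q|/eqP r|/eqP c].
  + have d k : k = (9 * (k %/ 9) + k %% 9)%N by rewrite mulnC -divn_eq.
    move: e; rewrite (d i) (d p) !pos_val_block ?ltn_mod // q => e.
    have q3 : i %/ 9 %/ 3 < 3 by lia.
    have q3' : i %/ 9 %% 3 < 3 by lia.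
    have := @mmboard_block_val_inj B (Ordinal q3) (Ordinal q3') (i %% 9) (p %% 9) mB.
    by rewrite !ltn_mod => /(_ isT isT e); lia.
  + move: e; rewrite /pos_val r => /(at_nat_row_inj mB ci cp); lia.
  + move: e; rewrite /pos_val c => /(at_nat_col_inj mB ri rp); lia.
- move=> l /allpairsP[[q m] [+ + ->]] _; rewrite mem_iota add0n => /= q9 m9.
  have [m1 m2 m3] : [/\ m.1.1 < m.2, m.1.2 < m.2 & m.2 < 9].
    by apply/and3P; move: m m9; apply/allP.
  rewrite !ltn_add2l m1 m2 !pos_val_block ?(ltn_trans m1 m3) ?(ltn_trans m2 m3) //.
  have q3 : q %/ 3 < 3 by lia.
  have q3' : q %% 3 < 3 by lia.
  have [_ /modmagicP h] := andP mB.
  by split=> //; exact: (h (Ordinal q3) (Ordinal q3') m m9).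
Qed.

Lemma entry_matrix_of B (r c : 'I_9) :
  entry (matrix_of (prefix_stack (pos_val B) 81)) r c = B (r, c).
Proof.
rewrite /entry (nth_map 0) ?size_iota // nth_iota // (nth_map 0) ?size_iota // nth_iota // !add0n.
set p := (X in (80 - X)%N).
have r9 := ltn_ord r; have c9 := ltn_ord c.
have p81 : p < 81 by rewrite /p; lia.
have -> : (80 - p = 81 - p.+1)%N by [].
rewrite nth_prefix_stack // /pos_val /at_nat; congr (val (B (_, _))); apply: inord9.
  by rewrite /pos_row /p; lia.
by rewrite /pos_col /p; lia.
Qed.

Lemma normalP (B : board) (f : nat -> nat -> nat) :
    (forall r c : 'I_9, f r c = B (r, c)) -> reflect (normal_form B) (normalb f).
Proof.
move=> fE; have fB r c : r < 9 -> c < 9 -> f r c = ent B r.+1 c.+1.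
  by move=> r9 c9; rewrite /ent !subn1 /= -fE !inordK.
rewrite /normal_form -!fB //; apply: (iffP and3P) => [[/allP h lt /eqnP e]|H].
  (* Each of the 27 equations is looked up in [normal_entries] by computation. *)
  repeat match goal with |- f ?r ?c = ?v /\ _ =>
    split; first exact: (elimT eqnP (h (r, c, v) isT)) end.
  by split.
move: H; do 27!case=> ?; move=> [lt e]; split=> //; last exact/eqnP.
by rewrite /normal_entries /=; repeat match goal with E : f ?r ?c = _ |- _ => rewrite {}E end.
Qed.

Lemma moved_bact (B : board) (g : {perm cell}) s t (b : bool) m u v :
    g = prodp s t * flip ^+ b ->
    (forall r c : 'I_9, entry m r c = B (r, c)) ->
    (forall i : 'I_9, nth 0 u i = s^-1 i) -> (forall i : 'I_9, nth 0 v i = t^-1 i) ->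
  forall r c : 'I_9, moved b u v m r c = bact g B (r, c).
Proof.
move=> -> mE uE vE r c; rewrite bactM /moved; case: b.
  by rewrite uE vE mE expg1 bact_flip bact_prodp.
by rewrite uE vE mE expg0 -bactM mulg1 bact_prodp.
Qed.

Lemma normalize (B : board) : mmboard B -> aligned B ->
  exists2 g, wreath centred g & normal_form (bact g B).
Proof.
move=> mB /(aligned_solution mB)/(allP solutions_check)/andP[+ _].
have mE := @entry_matrix_of B; move: (matrix_of _) mE => m mE.
move=> /hasP[b _ /hasP[u uS /hasP[v vS nf]]].
have [s sc su] := code_centred (allP short_codes_centred u uS).
have [t tc tv] := code_centred (allP short_codes_centred v vS).
(* [moved] expects codes of inverses, and the codes found are those of [s] and [t]. *)
exists (prodp s^-1 t^-1 * flip ^+ b); first by exists s^-1, t^-1, b; rewrite !groupV.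
by apply/(normalP _ nf)/moved_bact => // i; rewrite invgK ?su ?tv.
Qed.

(** This places every normal board among the solutions, so that [rigid] has been checked for it. *)
Lemma normal_aligned B : normal_form B -> aligned B.
Proof.
rewrite /normal_form /ent !subn1 /= => H k k3.
by move: H; do 27!case=> ?; case: k k3 => [|[|[|]]].
Qed.

Lemma normal_unique (B : board) g : mmboard B -> wreath centred g ->
  normal_form B -> normal_form (bact g B) -> bact g B = B.
Proof.
move=> mB [s [t [b [sc tc gE]]]] nB nB'.
have /andP[_] := allP solutions_check _ (aligned_solution mB (normal_aligned nB)).
have mE := @entry_matrix_of B; move: (matrix_of _) mE => m mE.
have cE := moved_bact gE mE (nth_perm_code s^-1) (nth_perm_code t^-1).
rewrite /rigid; have /(normalP mE) -> := nB.
have bI : b \in [:: false; true] by case: (b).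
have sI : perm_code s^-1 \in centred_codes by rewrite centred_perm_code ?groupV.
have tI : perm_code t^-1 \in centred_codes by rewrite centred_perm_code ?groupV.
move=> /allP/(_ b bI)/allP/(_ _ sI)/allP/(_ _ tI).
have /(normalP cE) -> := nB'.
move=> /allP h; apply/ffunP => -[r c]; apply: val_inj => /=.
by have /allP/(_ _ (mem_iota9 c))/eqnP := h _ (mem_iota9 r); rewrite cE mE.
Qed.

Theorem theorem2p2 (B0 : board) :
  mmboard B0 ->
  exists! B : board, [/\ B \in nest B0, mmboard B & normal_form B].
Proof.
move=> mB0; have [g1 [w1 mB1 aB1]] := align mB0.
have [g2 w2 nB2] := normalize mB1 aB1.
rewrite -bactM in nB2; have w := wreathM w1 w2.
have mB := mmboard_wreath w mB0.
exists (bact (g1 * g2) B0); split=> [|_ [/imsetP[h hH ->] _ nh]].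
  by split=> //; apply: imset_f; apply: wreath_Hmm.
(* Another normal board of the nest differs from the one constructed by [(g1 * g2)^-1 * h], which
   lies in the group covered by [normal_unique]. *)
have wh := wreathM (wreathV w) (Hmm_wreath mB0 hH).
have hE : bact h B0 = bact ((g1 * g2)^-1 * h) (bact (g1 * g2) B0) by rewrite -bactM mulKVg.
by rewrite hE in nh *; rewrite (normal_unique mB wh nB2 nh).
Qed.
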